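(* Let $\mathcal{C}$ be a full subcategory of the category of non-empty path-connected spaces and continuous maps, having the closed unit disk $D^2$ as an object, and let $\mathscr{H}(\mathcal{C})$ be its coreflective hull. For any based path-connected space $(X,x_0)$, the category $\mathbf{bCov}_{\mathscr{H}(\mathcal{C})}(X,x_0)$ of based $\mathscr{H}(\mathcal{C})$-coverings over $(X,x_0)$ has an initial object.
   Context: Maps are continuous functions. $\mathbf{Top}_0$ is the category of path-connected spaces and maps. The coreflective hull $\mathscr{H}(\mathcal{C})$ is the full subcategory of $\mathbf{Top}_0$ consisting of all path-connected spaces which are a quotient of a topological sum of objects of $\mathcal{C}$. An $\mathscr{H}(\mathcal{C})$-covering map is a map $p:\widetilde{X}\to X$ such that (1) $\widetilde{X}\in\mathscr{H}(\mathcal{C})$, and (2) for every $Y\in\mathscr{H}(\mathcal{C})$, $\tilde{x}\in\widetilde{X}$, $y\in Y$ and based map $f:(Y,y)\to(X,p(\tilde{x}))$ with $f_*(\pi_1(Y,y))\subseteq p_*(\pi_1(\widetilde{X},\tilde{x}))$, there is a unique map $\tilde{f}:(Y,y)\to(\widetilde{X},\tilde{x})$ with $p\circ\tilde{f}=f$. $\mathbf{bCov}_{\mathscr{H}(\mathcal{C})}(X,x_0)$ has as objects the based $\mathscr{H}(\mathcal{C})$-coverings $p:(\widetilde{X},\tilde{x}_0)\to(X,x_0)$; a morphism from $p:(\widetilde{X},\tilde{x}_0)\to(X,x_0)$ to $q:(\widetilde{Y},\tilde{y}_0)\to(X,x_0)$ is a based map $f:(\widetilde{X},\tilde{x}_0)\to(\widetilde{Y},\tilde{y}_0)$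 with $q\circ f=p$. *)

(* Defs.v *)
From HB Require Import structures.
From mathcomp Require Import all_boot all_order all_algebra.
From mathcomp Require Import mathcomp_extra boolp classical_sets functions.
From mathcomp Require Import set_interval reals topology homotopy.

Set Implicit Arguments.
Unset Strict Implicit.
Unset Printing Implicit Defensive.

Import Order.TTheory GRing.Theory Num.Theory.
Import numFieldTopology.Exports.

Local Open Scope classical_set_scope.
Local Open Scope ring_scope.

Record category := Category {
  Ob : Type ;
  Hom : Ob -> Ob -> Type ;
  id_hom : forall a, Hom a a ;
  comp_hom : forall a b c, Hom b c -> Hom a b -> Hom a c ;
  comp_id_left : forall a b (f : Hom a b), comp_hom (id_hom b) f = f ;
  comp_id_right : forall a b (f : Hom a b), comp_hom f (id_hom a) = f ;
  comp_assoc : forall a b c d (h : Hom c d) (g : Hom b c) (f : Hom a b),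
    comp_hom h (comp_hom g f) = comp_hom (comp_hom h g) f
}.

Definition initial_object (K : category) (a : Ob K) : Prop :=
  forall b : Ob K, exists! f : Hom a b, True.

Section unit_interval.
Variable R : realType.

Definition unit_interval : Type := `[0 : R, 1]%classic.

HB.instance Definition _ :=
  Topological.copy unit_interval (set_type `[0 : R, 1]%classic).

Lemma zero_in01 : (0 : R) \in `[0 : R, 1]%classic.
Proof. by rewrite inE /= in_itv /= lexx ler01. Qed.

Lemma one_in01 : (1 : R) \in `[0 : R, 1]%classic.
Proof. by rewrite inE /= in_itv /= lexx ler01. Qed.

Definition I0 : unit_interval := exist _ 0 zero_in01.
Definition I1 : unit_interval := exist _ 1 one_in01.

Lemma I0_neq_I1 : I0 != I1.
Proof. by apply/eqP => /(congr1 sval)/= /eqP; rewrite eq_sym oner_eq0. Qed.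

HB.instance Definition _ := isBiPointed.Build unit_interval I0_neq_I1.

Definition closed_disk : topologicalType :=
  set_type [set z : R * R | z.1 ^+ 2 + z.2 ^+ 2 <= 1].

Definition path_connected (X : topologicalType) : Prop :=
  forall x y : X, $| {path unit_interval from x to y in X} |.

End unit_interval.

Definition quotient_map (X Y : topologicalType) (q : X -> Y) : Prop :=
  range q = [set: Y] /\ forall U : set Y, open U <-> open (q @^-1` U).

(* A full subcategory C is encoded by its class of objects. The sums are indexed
   by a type J, i.e. by a set, even when C is a proper class. *)
Definition coreflective_hull (R : realType) (C : topologicalType -> Prop)
    (X : topologicalType) : Prop :=
  path_connected R X /\
  exists (J : choiceType) (F : J -> topologicalType),
    (forall j, C (F j)) /\ exists q : {j & F j} -> X, quotient_map q.

Record based_map (Y X : topologicalType) (y : Y) (x : X) := BasedMap {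
  based_map_fun :> continuousType Y X ;
  based_mapP : based_map_fun y = x
}.

Lemma based_map_eq (Y X : topologicalType) (y : Y) (x : X)
  (f g : based_map y x) : f =1 g -> f = g.
Proof.
case: f g => [f fyx] [g gyx] /= /continuousEP fg.
by case: _ / fg in gyx *; rewrite (Prop_irrelevance fyx gyx).
Qed.

Definition based_at (E X : topologicalType) (p : continuousType E X) (e : E) :
  based_map e (p e) := BasedMap (erefl (p e)).

Definition based_id (X : topologicalType) (x : X) : based_map x x :=
  based_at idfun x.

Section based_comp.
Variables (X Y Z : topologicalType) (x : X) (y : Y) (z : Z).
Variables (g : based_map y z) (f : based_map x y).

Lemma based_compP : (g \o f) x = z.
Proof. by rewrite /= based_mapP based_mapP. Qed.

Definition based_comp : based_map x z := @BasedMap _ _ x z (g \o f) based_compP.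

End based_comp.

Section fundamental_group.
Variable R : realType.
Notation I := (unit_interval R).

Definition path_homotopic (X : topologicalType) (a b : X)
    (g d : {path I from a to b in X}) : Prop :=
  exists h : I * I -> X,
    [/\ continuous h,
        forall s, h (s, zero) = g s,
        forall s, h (s, one) = d s &
        forall t, h (zero, t) = a /\ h (one, t) = b].

Definition loop (X : topologicalType) (x : X) : Type :=
  {path I from x to x in X}.

(* The underlying set of pi_1(X, x): homotopy classes, as sets of loops. The
   group law is not needed to compare images of homomorphisms. *)
Definition pi1 (X : topologicalType) (x : X) : set (set (loop x)) :=
  [set c | exists g : loop x, c = [set d : loop x | path_homotopic g d]].
Arguments pi1 {X} x.

Section induced.
Variables (Y X : topologicalType) (y : Y) (x : X) (f : based_map y x).

Lemma based_map_path_end (g : loop y) (t : I) : g t = y -> (f \o g) t = x.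
Proof. by move=> gt /=; rewrite gt based_mapP. Qed.

Definition loop_map (g : loop y) : loop x :=
  mk_path (@cts_fun _ _ (f \o g))
    (based_map_path_end (path_zero (s := g)))
    (based_map_path_end (path_one (s := g))).

(* The class of [g] is sent to the class of [f \o g]. *)
Definition pi1_map (c : set (loop y)) : set (loop x) :=
  [set d | exists2 g, c g & path_homotopic (loop_map g) d].

Definition pi1_image : set (set (loop x)) := pi1_map @` pi1 y.

End induced.

End fundamental_group.

Arguments pi1 R {X} x.
Arguments pi1_map R {Y X y x} f c.
Arguments pi1_image R {Y X y x} f.

Section covering.
Variables (R : realType) (C : topologicalType -> Prop).

Definition hull_covering (E X : topologicalType) (p : continuousType E X) :
    Prop :=
  coreflective_hull R C E /\
  forall (Y : topologicalType) (e : E) (y : Y) (f : based_map y (p e)),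
    coreflective_hull R C Y ->
    pi1_image R f `<=` pi1_image R (based_at p e) ->
    exists! g : based_map y e, p \o g =1 f.

Variables (X : topologicalType) (x0 : X).

Record based_covering := BasedCovering {
  total_space : topologicalType ;
  base_point : total_space ;
  projection : based_map base_point x0 ;
  projection_covering : hull_covering projection
}.

Definition covering_hom (P Q : based_covering) : Type :=
  {f : based_map (base_point P) (base_point Q) |
    projection Q \o f =1 projection P}.

Lemma covering_hom_eq (P Q : based_covering) (f g : covering_hom P Q) :
  sval f =1 sval g -> f = g.
Proof.
case: f g => [f fP] [g gP] /= /based_map_eq fg.
by case: _ / fg in gP *; rewrite (Prop_irrelevance fP gP).
Qed.

Lemma id_hom_over (P : based_covering) :
  projection P \o based_id (base_point P) =1 projection P.
Proof. by []. Qed.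

Lemma comp_hom_over (P Q S : based_covering)
    (g : covering_hom Q S) (f : covering_hom P Q) :
  projection S \o based_comp (sval g) (sval f) =1 projection P.
Proof. by move=> e; rewrite -(svalP f e) /= -(svalP g (sval f e)). Qed.

Program Definition bCov : category := {|
  Ob := based_covering ;
  Hom := covering_hom ;
  id_hom P := exist _ _ (@id_hom_over P) ;
  comp_hom P Q S g f := exist _ _ (@comp_hom_over P Q S g f)
|}.
Next Obligation. by move=> P Q f; apply: covering_hom_eq. Qed.
Next Obligation. by move=> P Q f; apply: covering_hom_eq. Qed.
Next Obligation. by move=> P Q S T h g f; apply: covering_hom_eq. Qed.

End covering.

(* Main.v *)
(** The initial covering is a fibre product of all based coverings. These form
    a proper class, but coverings with the same subgroup [p_* pi_1] map to each
    other by the lifting property, so one representative [E_k] for each realized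
    subgroup suffices. In [X * prod_k E_k] take the points whose coordinates lie
    over the same point of [X], then the path component of the base point, then
    its coreflection into the hull of [C]: a set is open when its preimage under
    every continuous map from an object of [C] is open. Lifts to this space are
    computed coordinatewise: its subgroup is contained in that of each [E_k], a
    path-connected space stays in one path component, and maps from the hull
    remain continuous for the coreflected topology. The disk retracts onto the
    interval, so paths remain continuous as well. *)

From HB Require Import structures.
Require Import Defs.
From mathcomp Require Import all_boot all_order all_algebra.
From mathcomp Require Import boolp classical_sets functions reals topology.
From mathcomp Require Import normedtype homotopy lra.

Set Implicit Arguments.
Unset Strict Implicit.
Unset Printing Implicit Defensive.

Import Order.TTheory GRing.Theory Num.Theory.
Import numFieldTopology.Exports.

Local Open Scope classical_set_scope.
Local Open Scope ring_scope.

(** * Continuity of composed, pasted and paired maps *)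

Lemma compose_continuous (X Y Z : topologicalType) (f : X -> Y) (g : Y -> Z) :
  continuous f -> continuous g -> continuous (g \o f).
Proof. by move=> cf cg x; apply: continuous_comp; [exact: cf|exact: cg]. Qed.

(** Where [u z] differs from [c], the pasted map agrees near [z] with one branch. Where [u z = c],
    both branches are continuous at [z] with the same value, so on the intersection of two
    neighbourhoods either choice lands in the target set. *)
Lemma paste_continuous (R : realType) (Z X : topologicalType) (u : Z -> R)
    (c : R) (f g : Z -> X) :
  continuous u -> continuous f -> continuous g ->
  (forall z, u z = c -> f z = g z) ->
  continuous (fun z => if u z <= c then f z else g z).
Proof.
move=> cu cf cg fg z.
rewrite /prop_for /continuous_at.
have [uz|uz|uz] := ltgtP (u z) c.
- apply: cvg_trans (cf z); apply: near_eq_cvg.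
  have : \forall w \near z, u w < c.
    by apply: (cu z [set r | r < c]); apply: open_nbhs_nbhs; split => //;
      exact: open_lt.
  by apply: filterS => w /ltW ->.
- apply: cvg_trans (cg z); apply: near_eq_cvg.
  have : \forall w \near z, c < u w.
    by apply: (cu z [set r | c < r]); apply: open_nbhs_nbhs; split => //;
      exact: open_gt.
  by apply: filterS => w; rewrite ltNge => /negbTE ->.
- move=> U fzU.
  have gzU : nbhs (g z) U by rewrite -fg.
  have fU : \forall w \near z, U (f w) := cf z U fzU.
  have gU : \forall w \near z, U (g w) := cg z U gzU.
  rewrite /= near_simpl; apply: filterS (filterI fU gU) => w [fwU gwU].
  by rewrite /=; case: ifP.
Qed.

Lemma pair_continuous (X Y Z : topologicalType) (f : X -> Y) (g : X -> Z) :
  continuous f -> continuous g -> continuous (fun x => (f x, g x)).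
Proof. by move=> cf cg x; exact: cvg_pair (cf x) (cg x). Qed.

Lemma fst_continuous (X Y : topologicalType) : continuous (@fst X Y).
Proof. by move=> z; exact: cvg_fst. Qed.

Lemma snd_continuous (X Y : topologicalType) : continuous (@snd X Y).
Proof. by move=> z; exact: cvg_snd. Qed.

(** * Reparametrization and concatenation of paths *)

Section interval.
Variable R : realType.
Notation I := (unit_interval R).

Lemma clip_subproof (r : R) :
  Num.max 0 (Num.min r 1) \in `[0 : R, 1]%classic.
Proof.
by rewrite inE /= in_itv /= le_max lexx /= ge_max ler01 ge_min lexx orbT.
Qed.

(** This retraction of the line onto the interval lets paths be reparametrized by any affine
    formula, without proofs that the values stay in the interval. *)
Definition clip (r : R) : I :=
  exist (fun x => x \in `[0, 1]%classic) _ (clip_subproof r).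

Definition coord (t : I) : R := \val t.

Lemma coord_continuous : continuous coord.
Proof. exact: initial_continuous. Qed.

Lemma clip_continuous : continuous clip.
Proof.
apply: continuous_comp_initial => r.
have -> : set_val \o clip = cst 0 \max (idfun \min cst 1) by [].
apply: continuous_max; first exact: cst_continuous.
by apply: continuous_min => //; exact: cst_continuous.
Qed.

Lemma coordK : cancel coord clip.
Proof.
move=> t; apply: val_inj => /=; rewrite /coord.
have := valP t; rewrite inE /= in_itv /= => /andP[t0 t1].
by rewrite min_l// max_r.
Qed.

Lemma clip_le0 (r : R) : r <= 0 -> clip r = zero.
Proof.
move=> r0; apply: val_inj => /=.
by rewrite min_l ?max_l// (le_trans r0).
Qed.

Lemma clip_ge1 (r : R) : 1 <= r -> clip r = one.
Proof. by move=> r1; apply: val_inj => /=; rewrite min_r// max_r. Qed.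

Lemma coord0 : coord zero = 0. Proof. by []. Qed.
Lemma coord1 : coord one = 1. Proof. by []. Qed.

Lemma clip_affine_continuous (a b : R) :
  continuous (fun t : I => clip (a * coord t + b)).
Proof.
move=> t; apply: continuous_comp; last exact: clip_continuous.
apply: (@continuousD R R^o); last exact: cst_continuous.
apply: (@continuousM R); first exact: cst_continuous.
exact: coord_continuous.
Qed.

Lemma path_inhabited (X : topologicalType) (a b : X) (f : I -> X) :
  continuous f -> f zero = a -> f one = b -> $| {path I from a to b in X} |.
Proof. by move=> cf f0 f1; apply: squash; exact: (mk_path cf f0 f1). Qed.

Lemma path_inhabited_sym (X : topologicalType) (a b : X) :
  $| {path I from a to b in X} | -> $| {path I from b to a in X} |.
Proof.
move=> [g].
apply: (@path_inhabited _ _ _ (fun t => g (clip (-1 * coord t + 1)))).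
- exact: compose_continuous (@clip_affine_continuous _ _) (@cts_fun _ _ g).
- by rewrite coord0 clip_ge1 ?path_one//; lra.
- by rewrite coord1 clip_le0 ?path_zero//; lra.
Qed.

Lemma path_inhabited_trans (X : topologicalType) (a b c : X) :
  $| {path I from a to b in X} | -> $| {path I from b to c in X} | ->
  $| {path I from a to c in X} |.
Proof.
move=> [g] [d].
(* Clipping makes each branch continuous on the whole interval, constant outside its own half. The
   [+ 0] matches the form of [clip_affine_continuous]. *)
apply: (@path_inhabited _ _ _ (fun t => if coord t <= 2^-1
  then g (clip (2 * coord t + 0)) else d (clip (2 * coord t + -1)))).
- apply: paste_continuous; first exact: coord_continuous.
  + exact: compose_continuous (@clip_affine_continuous _ _) (@cts_fun _ _ g).
  + exact: compose_continuous (@clip_affine_continuous _ _) (@cts_fun _ _ d).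
  + by move=> t ->; rewrite clip_ge1 ?clip_le0 ?path_zero ?path_one//; lra.
- by rewrite coord0 invr_ge0 ler0n clip_le0 ?path_zero//; lra.
- rewrite coord1 ifF; last by apply/negbTE; rewrite -ltNge; lra.
  by rewrite clip_ge1 ?path_one//; lra.
Qed.

Lemma unit_interval_path_connected : path_connected R I.
Proof.
move=> s t.
apply: (@path_inhabited _ _ _
  (fun u => clip ((coord t - coord s) * coord u + coord s))).
- exact: clip_affine_continuous.
- by rewrite coord0 mulr0 add0r coordK.
- by rewrite coord1 mulr1 subrK coordK.
Qed.

Lemma path_connected_image (Y X : topologicalType) (f : Y -> X) (y z : Y) :
  continuous f -> path_connected R Y -> $| {path I from f y to f z in X} |.
Proof.
move=> cf /(_ y z) [g]; apply: (@path_inhabited _ _ _ (f \o g)).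
- exact: compose_continuous (@cts_fun _ _ g) cf.
- by rewrite /= path_zero.
- by rewrite /= path_one.
Qed.

(** * Path homotopy and images of fundamental groups *)

Section path_homotopic.
Variables (X : topologicalType) (a b : X).
Implicit Types g d e : {path I from a to b in X}.

Lemma path_homotopic_refl g : path_homotopic g g.
Proof.
exists (fun z => g z.1); split => //.
- exact: compose_continuous (@fst_continuous _ _) (@cts_fun _ _ g).
- by move=> t; rewrite path_zero path_one.
Qed.

Lemma path_homotopic_trans g d e :
  path_homotopic g d -> path_homotopic d e -> path_homotopic g e.
Proof.
move=> [h [ch h0 h1 hab]] [k [ck k0 k1 kab]].
have cpair (m n : R) :
    continuous (fun z : I * I => (z.1, clip (m * coord z.2 + n))).
  apply: pair_continuous; first exact: fst_continuous.
  exact: compose_continuous (@snd_continuous _ _)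
    (@clip_affine_continuous m n).
(* The homotopies are stacked in the second coordinate, which is the deformation parameter. *)
exists (fun z => if coord z.2 <= 2^-1
  then h (z.1, clip (2 * coord z.2 + 0))
  else k (z.1, clip (2 * coord z.2 + -1))); split.
- apply: (@paste_continuous _ _ _ (coord \o snd)).
  + exact: compose_continuous (@snd_continuous _ _) coord_continuous.
  + exact: compose_continuous (cpair _ _) ch.
  + exact: compose_continuous (cpair _ _) ck.
  + by move=> z /= ->; rewrite clip_ge1 ?clip_le0 ?h1 ?k0//; lra.
- by move=> s /=; rewrite coord0 invr_ge0 ler0n clip_le0 ?h0//; lra.
- move=> s /=; rewrite coord1 ifF; last by apply/negbTE; rewrite -ltNge; lra.
  by rewrite clip_ge1 ?k1//; lra.
- by move=> t /=; case: ifP => _; [exact: hab|exact: kab].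
Qed.

End path_homotopic.

Lemma loop_map_homotopic (Y X : topologicalType) (y : Y) (x : X)
    (f : based_map y x) (g d : loop R y) :
  path_homotopic g d -> path_homotopic (loop_map f g) (loop_map f d).
Proof.
move=> [h [ch h0 h1 hy]]; exists (f \o h); split.
- exact: compose_continuous ch (@cts_fun _ _ f).
- by move=> s /=; rewrite h0.
- by move=> s /=; rewrite h1.
- by move=> t /=; have [-> ->] := hy t; rewrite based_mapP.
Qed.

Lemma pi1_map_class (Y X : topologicalType) (y : Y) (x : X)
    (f : based_map y x) (g : loop R y) :
  pi1_map R f [set d | path_homotopic g d] =
  [set d | path_homotopic (loop_map f g) d].
Proof.
apply/seteqP; split => [d [g' gg' fd]|d gd].
  exact: path_homotopic_trans (loop_map_homotopic f gg') fd.
by exists g => //; exact: path_homotopic_refl.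
Qed.

(** A loop of [Y] pushed forward along [h] has the same image in [X]. Thus any factorization through
    [p] gives the inclusion required by the lifting property. *)
Lemma pi1_image_factor (Y E X : topologicalType) (y : Y) (e : E) (x : X)
    (f : based_map y x) (p : based_map e x) (h : based_map y e) :
  p \o h =1 f -> pi1_image R f `<=` pi1_image R p.
Proof.
move=> phf _ [_ [g ->] <-].
exists [set d | path_homotopic (loop_map h g) d].
  by exists (loop_map h g).
rewrite !pi1_map_class.
suff -> : loop_map p (loop_map h g) = loop_map f g by [].
by apply/path_eqP => t; exact: phf.
Qed.

End interval.

Lemma set_type_lift (Y P : topologicalType) (A : set P) (f : Y -> P) :
  continuous f -> (forall y, A (f y)) ->
  exists g : continuousType Y (set_type A), forall y, \val (g y) = f y.
Proof.
move=> cf Af.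
pose g y : set_type A := exist _ (f y) (mem_set (Af y)).
have cg : continuous g by apply: continuous_comp_initial.
by exists (mkcts cg).
Qed.

(** * Path components as path-connected subspaces *)

Section path_component.
Variables (R : realType) (P : topologicalType) (z0 : P).
Notation I := (unit_interval R).

Definition path_component : set P :=
  [set z | $| {path I from z0 to z in P} |].

Lemma path_component_base : path_component z0.
Proof.
by apply: (@path_inhabited _ _ _ _ (cst z0)) => //; exact: cst_continuous.
Qed.

Lemma path_component_image (Y : topologicalType) (f : Y -> P) (y : Y) :
  continuous f -> path_connected R Y -> path_component (f y) ->
  forall z, path_component (f z).
Proof.
move=> cf Yc fy z; apply: path_inhabited_trans fy _.
exact: path_connected_image.
Qed.

Lemma path_component_path_connected :
  path_connected R (set_type path_component).
Proof.
move=> a b.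
have aP := set_mem (valP a); have bP := set_mem (valP b).
have [g] := path_inhabited_trans (path_inhabited_sym aP) bP.
(* A path starting in the component never leaves it, since the interval is path connected. It
   therefore lifts to the subspace. *)
have gA : forall t, path_component (g t).
  apply: (@path_component_image _ _ zero); first exact: cts_fun.
    exact: unit_interval_path_connected.
  by rewrite path_zero.
have [h hg] := set_type_lift (@cts_fun _ _ g) gA.
apply: (@path_inhabited _ _ _ _ h); first exact: cts_fun.
- by apply: val_inj; rewrite hg; exact: (path_zero (s := g)).
- by apply: val_inj; rewrite hg; exact: (path_one (s := g)).
Qed.

End path_component.

(** * Coreflection into the hull *)

(* [C] only selects the topology put on the carrier of [P]. *)
Definition coreflection (C : topologicalType -> Prop) (P : topologicalType) :
  Type := P.

Section coreflection.
Variables (C : topologicalType -> Prop) (P : topologicalType).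
Local Notation cP := (coreflection C P).

Definition coreflection_open : set_system cP :=
  [set U | forall (Z : topologicalType) (g : Z -> P),
     C Z -> continuous g -> open (g @^-1` U)].

Lemma coreflection_openT : coreflection_open [set: cP].
Proof. by move=> Z g _ _; rewrite preimage_setT; exact: openT. Qed.

Lemma coreflection_openI : setI_closed coreflection_open.
Proof.
move=> U V oU oV Z g CZ cg; rewrite preimage_setI.
by apply: openI; [exact: oU|exact: oV].
Qed.

Lemma coreflection_open_bigcup (J : Type) (U : J -> set cP) :
  (forall j, coreflection_open (U j)) -> coreflection_open (\bigcup_j U j).
Proof.
move=> oU Z g CZ cg; rewrite preimage_bigcup.
by apply: bigcup_open => j _; exact: oU.
Qed.

HB.instance Definition _ := Choice.copy cP P.
HB.instance Definition _ := isOpenTopological.Build cP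
  coreflection_openT coreflection_openI coreflection_open_bigcup.

Lemma coreflection_openE : open = coreflection_open.
Proof. by []. Qed.

Definition counit : cP -> P := id.

Lemma counit_continuous : continuous counit.
Proof.
apply/continuousP => U oU.
by rewrite coreflection_openE => Z g _ /continuousP; exact.
Qed.

Lemma coreflection_continuous (Z : topologicalType) (g : Z -> cP) :
  C Z -> continuous (counit \o g) -> continuous g.
Proof.
move=> CZ cg; apply/continuousP => U.
by rewrite coreflection_openE => /(_ Z g CZ cg).
Qed.

(** Openness in [Y] is tested on each summand [F j], and there the composite with [g] is one of the
    test maps defining the coreflected topology. *)
Lemma coreflection_continuous_quotient (J : choiceType)
    (F : J -> topologicalType) (Y : topologicalType) (q : {j & F j} -> Y)
    (g : Y -> cP) :
  (forall j, C (F j)) -> quotient_map q -> continuous (counit \o g) ->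
  continuous g.
Proof.
move=> CF [_ qY] cg; apply/continuousP => U; rewrite coreflection_openE => oU.
apply/qY/sigT_openP => j; apply: (oU _ (counit \o g \o q \o existT _ j)) => //.
apply: compose_continuous; first exact: existT_continuous.
by apply: compose_continuous cg; apply/continuousP => V /qY.
Qed.

Lemma coreflection_quotient (D : topologicalType) :
  C D -> [set: D] !=set0 ->
  exists (J : choiceType) (F : J -> topologicalType),
    (forall j, C (F j)) /\ exists q : {j & F j} -> cP, quotient_map q.
Proof.
(* One test map suffices to detect that a given [U] is not open, so a set of
   test maps generates the topology even when [C] is a proper class; choosing
   them to meet each nonempty [U], singletons included, makes the sum cover. *)
move=> CD [d _].
pose J : choiceType := set_type [set U : set P | U !=set0].
have /choice[F FP] (U : J) : exists Zg : {Z : topologicalType & Z -> P},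
    [/\ C (projT1 Zg), continuous (projT2 Zg),
        projT2 Zg @^-1` \val U !=set0 &
        open (projT2 Zg @^-1` \val U) -> coreflection_open (\val U)].
  have [x Ux] := set_mem (valP U).
  have [oU|] := pselect (coreflection_open (\val U)).
    (* For open [U] only the preimage has to be nonempty: it is all of the inhabited space [D]. *)
    exists (existT _ D (cst x)); split => //=; first exact: cst_continuous.
    by exists d.
  move=> /existsNP[Z] /existsNP[g] /not_implyP[CZ] /not_implyP[cg nU].
  exists (existT _ Z g); split => //.
  (* A map witnessing that [U] is not open automatically meets [U], because an empty preimage would
     be open. *)
  apply/set0P/negP => /eqP gU0.
  by apply: nU; rewrite gU0; exact: open0.
have inJ (U : set P) : U !=set0 -> exists V : J, \val V = U.
  by move=> U0; exists (exist (fun V => V \in _) U (mem_set U0)).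
exists J, (fun U => projT1 (F U)); split; first by move=> U; have [] := FP U.
exists (fun Uz => projT2 (F (projT1 Uz)) (projT2 Uz)); split.
  apply/seteqP; split => // x _.
  have [|V Vx] := inJ [set x]; first by exists x.
  have [_ _ [z]] := FP V; rewrite Vx => zx _.
  by exists (existT _ V z).
move=> U; rewrite coreflection_openE; split=> [oU|].
  apply/sigT_openP => V; have [CF cF _ _] := FP V.
  exact: (oU _ _ CF cF).
move=> /sigT_openP oU.
have [->|/set0P U0] := eqVneq U set0.
  by rewrite -coreflection_openE; exact: open0.
have [V VU] := inJ U U0.
by have [_ _ _] := FP V; rewrite VU; apply; exact: oU.
Qed.

(** Extended over the disk by the retraction [r], a path becomes a map from an object of [C], hence
    continuous into [cP]. Restriction along the radius [s] recovers the path. *)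
Lemma coreflection_path_connected (R : realType) :
  C (closed_disk R) -> path_connected R P -> path_connected R cP.
Proof.
move=> CD Pc a b; have [g] := Pc a b.
pose r (z : closed_disk R) : unit_interval R := clip (\val z).1.
have cr : continuous r.
  apply: compose_continuous (@clip_continuous R).
  by apply: compose_continuous (@fst_continuous _ _); exact: initial_continuous.
have sP (t : unit_interval R) : (coord t) ^+ 2 + 0 ^+ 2 <= 1 :> R.
  have := valP t; rewrite inE /= in_itv /= -/(coord t) => /andP[t0 t1].
  by rewrite expr0n addr0 expr_le1.
have [s sE] : exists s : continuousType (unit_interval R) (closed_disk R),
    forall t, \val (s t) = (coord t, 0).
  apply: set_type_lift => //.
  by apply: pair_continuous; [exact: coord_continuous|exact: cst_continuous].
have rs : r \o s =1 id by move=> t; rewrite /= /r sE coordK.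
have cgr : continuous (g \o r : closed_disk R -> cP).
  apply: coreflection_continuous => //.
  exact: compose_continuous cr (@cts_fun _ _ g).
apply: (@path_inhabited _ cP _ _ (g \o r \o s)).
- exact: compose_continuous (@cts_fun _ _ s) cgr.
- by rewrite /= [r _]rs path_zero.
- by rewrite /= [r _]rs path_one.
Qed.

Lemma coreflection_hull (R : realType) :
  C (closed_disk R) -> path_connected R P -> coreflective_hull R C cP.
Proof.
move=> CD Pc; split; first exact: coreflection_path_connected.
apply: (coreflection_quotient CD).
have D0 : [set z : R * R | z.1 ^+ 2 + z.2 ^+ 2 <= 1] (0, 0).
  by rewrite /= expr0n addr0 ler01.
by exists (exist (fun z => z \in _) _ (mem_set D0)).
Qed.

Lemma coreflection_continuous_hull (R : realType) (Y : topologicalType)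
    (g : Y -> cP) :
  coreflective_hull R C Y -> continuous (counit \o g) -> continuous g.
Proof.
move=> [_ [J [F [CF [q qY]]]]]; exact: coreflection_continuous_quotient CF qY.
Qed.

End coreflection.

(** * Fibre products in the hull *)

Lemma prod_continuous (K : eqType) (Y : topologicalType)
    (E : K -> topologicalType) (v : forall k, Y -> E k) :
  (forall k, continuous (v k)) ->
  continuous (fun y => (fun k => v k y) : prod_topology E).
Proof.
move=> cv y; apply/cvg_sup => k U.
move=> [_ [[W oW <-] Wy] WU]; apply: filterS WU _.
by apply: (cv k y); exact: open_nbhs_nbhs.
Qed.

(** The last two clauses are the universal property for sources in the hull: joint injectivity gives
    uniqueness, and compatible maps assemble. The base point [l] is arbitrary because coverings must
    lift at every point. *)
Lemma hull_fibre_product (R : realType) (C : topologicalType -> Prop)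
    (X : topologicalType) (x0 : X) (K : choiceType) (E : K -> topologicalType)
    (e0 : forall k, E k) (p : forall k, based_map (e0 k) x0) :
  C (closed_disk R) ->
  exists (L : topologicalType) (l0 : L) (u : based_map l0 x0)
      (v : forall k, based_map l0 (e0 k)),
    [/\ coreflective_hull R C L,
        forall k, p k \o v k =1 u,
        forall a b, u a = u b -> (forall k, v k a = v k b) -> a = b &
        forall (Y : topologicalType) (y : Y) (l : L) (f : based_map y (u l))
            (g : forall k, based_map y (v k l)),
          coreflective_hull R C Y -> (forall k, p k \o g k =1 f) ->
          exists h : based_map y l, u \o h =1 f /\ forall k, v k \o h =1 g k].
Proof.
move=> CD.
(* The factor [X] supplies the projection even for empty [K]. *)
pose S : set (X * prod_topology E) := [set z | forall k, p k (z.2 k) = z.1].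
have Sz0 : S (x0, e0) by move=> k; exact: based_mapP.
pose s0 : set_type S := exist (fun z => z \in S) _ (mem_set Sz0).
pose A := path_component R s0.
pose L : topologicalType := coreflection C (set_type A).
pose l0 : L := exist (fun z => z \in A) _ (mem_set (path_component_base R s0)).
pose i : L -> set_type A := @counit C _.
pose j (l : L) : X * prod_topology E := \val (\val (i l)).
have cj : continuous j.
  apply: compose_continuous (@initial_continuous _ _ _).
  apply: compose_continuous (@initial_continuous _ _ _).
  exact: counit_continuous.
have cu : continuous (fst \o j).
  exact: compose_continuous cj (@fst_continuous _ _).
have cv k : continuous ((fun z : prod_topology E => z k) \o snd \o j).
  apply: compose_continuous cj _.
  apply: compose_continuous (@snd_continuous _ _) _.
  exact: proj_continuous.
pose u : based_map l0 x0 := @BasedMap _ _ l0 x0 (mkcts cu) erefl.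
pose v k : based_map l0 (e0 k) := @BasedMap _ _ l0 (e0 k) (mkcts (cv k)) erefl.
have uv k : p k \o v k =1 u by move=> l; exact: (set_mem (valP (\val (i l)))).
exists L, l0, u, v; split => //.
- by apply: coreflection_hull => //; exact: path_component_path_connected.
- move=> a b uab vab; suff jab : j a = j b by exact: (val_inj (val_inj jab)).
  rewrite [LHS]surjective_pairing [RHS]surjective_pairing; congr pair => //.
  by apply: functional_extensionality_dep.
move=> Y y l f g Yh pgf.
pose h0 (z : Y) : X * prod_topology E := (f z, fun k => g k z).
have ch0 : continuous h0.
  apply: pair_continuous; first exact: cts_fun.
  by apply: prod_continuous => k; exact: cts_fun.
have Sh0 z : S (h0 z) by move=> k; exact: pgf.
have [h1 h1E] := set_type_lift ch0 Sh0.
(* The base point goes to a point of the component, so path connectedness of [Y] keeps the whole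
   image there. *)
have h1y : h1 y = \val (i l).
  apply: val_inj; rewrite h1E /h0 [RHS]surjective_pairing; congr pair.
    exact: based_mapP.
  by apply: functional_extensionality_dep => k; exact: based_mapP.
have h1A z : A (h1 z).
  apply: (path_component_image (y := y)); [exact: cts_fun|by case: Yh|].
  by rewrite h1y; exact: (set_mem (valP (i l))).
have [h2 h2E] := set_type_lift (@cts_fun _ _ h1) h1A.
have ch : continuous (h2 : Y -> L).
  by apply: coreflection_continuous_hull Yh _; exact: cts_fun.
have hy : mkcts ch y = l by apply: val_inj; rewrite [LHS]h2E.
have jh z : j (mkcts ch z) = h0 z := etrans (congr1 val (h2E z)) (h1E z).
exists (BasedMap hy); split => [z|k z].
  exact: (congr1 fst (jh z)).
exact: (congr1 (fun w => w.2 k) (jh z)).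
Qed.

(** * Lifting between coverings and the initial object *)

Lemma covering_lift (R : realType) (C : topologicalType -> Prop)
    (E X Y : topologicalType) (e : E) (x : X) (y : Y) (p : based_map e x)
    (f : based_map y x) :
  hull_covering R C p -> coreflective_hull R C Y ->
  pi1_image R f `<=` pi1_image R p ->
  exists! g : based_map y e, p \o g =1 f.
(* Eliminating the base point equation turns [x] into [p e], the form used in [hull_covering]. *)
Proof. by case: p => p pe; case: x / pe f => f [_ +] Yh; exact. Qed.

(** Both morphisms lift the projection of [P] through that of [Q], and the total space of [P] lies
    in the hull. *)
Lemma covering_hom_unique (R : realType) (C : topologicalType -> Prop)
    (X : topologicalType) (x0 : X) (P Q : based_covering R C x0)
    (f g : covering_hom P Q) :
  f = g.
Proof.
apply: covering_hom_eq.
have [Ph _] := projection_covering P.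
have [h [_ hE]] := covering_lift (projection_covering Q) Ph
  (@pi1_image_factor _ _ _ _ _ _ _ _ _ _ (svalP f)).
by rewrite -(hE _ (svalP f)) -(hE _ (svalP g)).
Qed.

Lemma covering_fibre_product (R : realType) (C : topologicalType -> Prop)
    (X : topologicalType) (x0 : X) (K : choiceType)
    (Q : K -> based_covering R C x0) :
  C (closed_disk R) ->
  exists P : based_covering R C x0, forall k, $| covering_hom P (Q k) |.
Proof.
move=> CD.
have [L [l0 [u [v [Lh uv uv_inj uvP]]]]] :=
  hull_fibre_product (fun k => projection (Q k)) CD.
suff cu : hull_covering R C u.
  exists (BasedCovering cu) => k; apply: squash.
  exact: (exist _ (v k) (uv k)).
split => // Y l y f Yh fu.
(* The [k]-th projection is rebased at [v k l]. Since [u] factors through it, the condition on [f]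
   passes from [u] to each [p k]. *)
pose p k : based_map (v k l) (u l) :=
  @BasedMap _ _ (v k l) (u l) (projection (Q k)) (uv k l).
have lift k : exists! g : based_map y (v k l), projection (Q k) \o g =1 f.
  apply: (covering_lift (p := p k) (projection_covering (Q k)) Yh) => c /fu.
  exact: (pi1_image_factor (h := based_at (v k) l)).
pose g k := sval (cid (lift k)).
have gP k : projection (Q k) \o g k =1 f by have [] := svalP (cid (lift k)).
have g_uniq k (g' : based_map y (v k l)) :
    projection (Q k) \o g' =1 f -> g k = g'.
  by have [_] := svalP (cid (lift k)); exact.
have [h [uh vh]] := uvP Y y l f g Yh gP.
exists h; split => // h' uh'.
apply: based_map_eq => z; apply: uv_inj => [|k].
  exact: etrans (uh z) (esym (uh' z)).
(* Each coordinate of a competing lift [h'] lifts [f] through [Q k], so it must be [g k]. *)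
have /g_uniq gE : projection (Q k) \o based_comp (based_at (v k) l) h' =1 f.
  by move=> w; exact: etrans (uv k (h' w)) (uh' w).
by rewrite [LHS](vh k z) gE.
Qed.

Theorem theorem32 (R : realType) (C : topologicalType -> Prop)
    (C_path_connected : forall Y : topologicalType,
      C Y -> [set: Y] !=set0 /\ path_connected R Y)
    (C_disk : C (closed_disk R))
    (X : topologicalType) (X_path_connected : path_connected R X) (x0 : X) :
  exists P : Ob (bCov R C x0), initial_object P.
Proof.
pose K : choiceType := set_type [set H : set (set (loop R x0)) |
  exists Q : based_covering R C x0, pi1_image R (projection Q) = H].
have /choice[Q QE] (k : K) :
  exists Q : based_covering R C x0, pi1_image R (projection Q) = \val k.
  exact: (set_mem (valP k)).
have [P PQ] := covering_fibre_product Q C_disk.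
exists P => S.
suff [f] : $| covering_hom P S |.
  by exists f; split => // g _; exact: covering_hom_unique.
have HS : [set H | exists Q : based_covering R C x0,
  pi1_image R (projection Q) = H] (pi1_image R (projection S)) by exists S.
pose k : K := exist (fun H => H \in _) _ (mem_set HS).
have [f] := PQ k.
have [Qh _] := projection_covering (Q k).
(* The representative [Q k] has the same subgroup as [S], so its projection lifts through [S].
   Composition with [P] to [Q k] gives the required morphism. *)
have QkS : pi1_image R (projection (Q k)) = pi1_image R (projection S) := QE k.
have [g [gS _]] : exists! g : based_map (base_point (Q k)) (base_point S),
    projection S \o g =1 projection (Q k).
  by apply: (covering_lift (projection_covering S) Qh); rewrite QkS.
pose gQ : covering_hom (Q k) S := exist _ g gS.
exact: squash (@comp_hom (bCov R C x0) _ _ _ gQ f).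
Qed.
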